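(* Let $\hat\sigma_1,\hat\sigma_2,\hat\sigma_3$ be the Pauli matrices, let $\alpha_1,\alpha_2,\alpha_3\in\mathbb{R}$, and let $$\Omega = e^{-i(\alpha_1\hat\sigma_1\otimes\hat\sigma_1+\alpha_2\hat\sigma_2\otimes\hat\sigma_2+\alpha_3\hat\sigma_3\otimes\hat\sigma_3)}.$$ Let $\mathcal{S}=\{n\pi/2 : n\in\{0,1,2,\dots\}\}$ and suppose exactly one of $\alpha_1,\alpha_2,\alpha_3$ lies in $\mathcal{S}$ (a ''two-parameter family''). Let $U=(\mathcal{L}_1\otimes\mathcal{L}_2)\,\Omega\,(\mathcal{R}_1\otimes\mathcal{R}_2)$ for arbitrary single-qubit unitaries $\mathcal{L}_1,\mathcal{L}_2,\mathcal{R}_1,\mathcal{R}_2$. Then for every two-qubit density operator $\rho^{SE}$ on $\mathbb{C}^2_S\otimes\mathbb{C}^2_E$ there exist a single-qubit unitary $V$ acting on $S$ (whose induced rotation $\mathcal{O}_V\in SO(3)$ on the Bloch/correlation indices is a product of Givens rotations) and a single-qubit density operator $\zeta^E$ such that $$\operatorname{Tr}_E\big[U (V\otimes\mathbb{I})\rho^{SE}(V^\dagger\otimes\mathbb{I})U^\dagger\big]=\operatorname{Tr}_E\big[U\big(V\rho^S V^\dagger\otimes\zeta^E\big)U^\dagger\big],$$ where $\rho^S=\operatorname{Tr}_E\rho^{SE}$; i.e. after applying $V$ on the system, the system dynamics are $U$-generated by a product state.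
   Context: For a global two-qubit unitary $U$ and a joint state $\tau^{SE}$ with $\tau^S=\operatorname{Tr}_E\tau^{SE}$, the system dynamics $\tau^S\mapsto\operatorname{Tr}_E(U\tau^{SE}U^\dagger)$ are said to be $U$-generated by a product state if there is a valid single-qubit density operator $\zeta^E$ with $\operatorname{Tr}_E(U\tau^{SE}U^\dagger)=\operatorname{Tr}_E(U(\tau^S\otimes\zeta^E)U^\dagger)$. A local unitary $V$ on the system induces the orthogonal matrix $\mathcal{O}_{ij}=\tfrac12\operatorname{Tr}(\hat\sigma_i V\hat\sigma_j V^\dagger)$, which acts on the system Bloch vector and on the left of the correlation matrix $t_{ij}=\operatorname{Tr}(\rho^{SE}\hat\sigma_i\otimes\hat\sigma_j)$. A Givens rotation is a $3\times3$ rotation by an angle $\theta$ in a coordinate plane $(i,j)$: identity on the remaining coordinate, entries $\cos\theta$ at $(i,i),(j,j)$, and $\mp\sin\theta$ off-diagonal. *)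

(* Defs.v *)
From HB Require Import structures.
From mathcomp Require Import all_boot all_order all_algebra.
From mathcomp Require Import complex mxtens.
From mathcomp Require Import classical_sets boolp filter reals topology normedtype sequences trigo.

Set Implicit Arguments.
Unset Strict Implicit.
Unset Printing Implicit Defensive.

Import Order.TTheory GRing.Theory Num.Theory numFieldNormedType.Exports.
Local Open Scope ring_scope.
Local Open Scope complex_scope.
Local Open Scope classical_set_scope.

Section Defs.
Variable R : realType.
Local Notation C := R[i].

Definition adjmx {m n} (A : 'M[C]_(m, n)) : 'M[C]_(n, m) := (map_mx conjc A)^T.

Definition unitary {n} (U : 'M[C]_n) : Prop :=
  U *m adjmx U = 1%:M /\ adjmx U *m U = 1%:M.

Definition density {n} (rho : 'M[C]_n) : Prop :=
  [/\ adjmx rho = rho,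
      (forall v : 'cV[C]_n, 0 <= (adjmx v *m rho *m v) 0 0)
    & \tr rho = 1].

(* Pauli matrices sigma_1, sigma_2, sigma_3, indexed by k : 'I_3
   (k = 0,1,2 stands for sigma_(k+1)) *)
Definition pauli (k : 'I_3) : 'M[C]_2 :=
  \matrix_(a < 2, b < 2)
    match nat_of_ord k with
    | 0 => if a != b then 1 else 0
    | 1 => if (nat_of_ord a == 0%N) && (nat_of_ord b == 1%N) then - 'i
           else if (nat_of_ord a == 1%N) && (nat_of_ord b == 0%N) then 'i
           else 0
    | _ => if a == b then (if nat_of_ord a == 0%N then 1 else -1) else 0
    end.

(* partial trace over the second (environment) tensor factor;
   indices follow the convention of `tensmx` (mxtens_index (i, k)) *)
Definition ptrE (M : 'M[C]_(2 * 2)) : 'M[C]_2 :=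
  \matrix_(i, j) \sum_(k < 2) M (mxtens_index (i, k)) (mxtens_index (j, k)).

Definition mxpow {n} (A : 'M[C]_n) (k : nat) : 'M[C]_n := iter k (mulmx A) 1%:M.
Definition expsum {n} (A : 'M[C]_n) (N : nat) : 'M[C]_n :=
  \sum_(k < N) ((k`!)%:R^-1 *: mxpow A k).

(* E = exp(A): entrywise convergence of the exponential series
   (convergence in C = convergence of real and imaginary parts) *)
Definition is_expmx {n} (A E : 'M[C]_n) : Prop :=
  forall i j,
    (fun N : nat => complex.Re (expsum A N i j) : R) @ \oo --> (complex.Re (E i j) : R) /\
    (fun N : nat => complex.Im (expsum A N i j) : R) @ \oo --> (complex.Im (E i j) : R).

Definition inS (a : R) : Prop := exists n : nat, a = n%:R * pi / 2.

Definition exactly_one_inS (a1 a2 a3 : R) : Prop :=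
  [\/ inS a1 /\ ~ inS a2 /\ ~ inS a3,
      ~ inS a1 /\ inS a2 /\ ~ inS a3
    | ~ inS a1 /\ ~ inS a2 /\ inS a3].

Definition Hgen (a1 a2 a3 : R) : 'M[C]_(2 * 2) :=
  (a1%:C *: (pauli 0 *t pauli 0)) + (a2%:C *: (pauli 1 *t pauli 1))
  + (a3%:C *: (pauli 2 *t pauli 2)).

Definition rotO (V : 'M[C]_2) : 'M[C]_3 :=
  \matrix_(a, b) (2%:R^-1 * \tr (pauli a *m V *m pauli b *m adjmx V)).

Definition givens (p q : 'I_3) (theta : R) : 'M[R]_3 :=
  \matrix_(a, b)
    if a == b then (if (a == p) || (a == q) then cos theta else 1)
    else if (a == p) && (b == q) then - sin theta
    else if (a == q) && (b == p) then sin theta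
    else 0.

Definition givens_product (O : 'M[C]_3) : Prop :=
  exists gs : seq ('I_3 * 'I_3 * R),
    all (fun g => g.1.1 != g.1.2) gs /\
    O = map_mx (fun x : R => x%:C)
          (\prod_(g <- gs) givens g.1.1 g.1.2 g.2).

End Defs.

(* Main.v *)
(** Take [zeta] to be the reduced environment state and put [D := rho - rhoS *t zeta].
    Both partial traces of [D] vanish, so only its correlation matrix
    [t i j = \tr ((s_i *t s_j) *m D)] matters.  For a cyclic permutation [(k, l, m)]
    of the axes, and with [c] and [s] the cosines and sines of the doubled angles,
    conjugating [s_k *t 1] by the adjoint of [Omega] gives
      [c_l c_m (s_k *t 1) + s_l c_m (s_m *t s_l) - c_l s_m (s_l *t s_m) + s_l s_m (1 *t s_k)],
    so the [k]-th Bloch component of the evolved [ptrE D] is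
    [s_l c_m t_ml - c_l s_m t_lm].  When [sin (2 a_k) = 0], all three components vanish
    as soon as [t_kl = t_km = 0] and [s_l c_m t_ml = c_l s_m t_lm].  A unitary on the
    system rotates the columns of [t], and four Givens rotations suffice: two align
    column [l] with axis [l], one about axis [l] kills [t_km], and one about axis [k]
    solves the remaining linear equation.

    That the rotation of any unitary is a product of Givens rotations is a QR argument:
    Givens rotations make it lower triangular with nonnegative last two diagonal
    entries, and such a rotation is the identity. *)

Require Import Defs.
From mathcomp Require Import all_boot all_order all_algebra.
From mathcomp Require Import complex mxtens.
From mathcomp Require Import classical_sets boolp filter reals topology normedtype sequences trigo.
From mathcomp Require Import ring.
Import Order.TTheory GRing.Theory Num.Theory.
Import numFieldNormedType.Exports.
Local Open Scope ring_scope.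
Local Open Scope complex_scope.

Set Implicit Arguments.
Unset Strict Implicit.
Unset Printing Implicit Defensive.

Local Notation evolve U M := (U *m M *m adjmx U).

Section TensorProduct.
Variable K : comPzRingType.

Lemma sum_mxtens_index (V : nmodType) m n (F : 'I_(m * n) -> V) :
  \sum_k F k = \sum_i \sum_j F (mxtens_index (i, j)).
Proof.
rewrite pair_big /= (reindex (@mxtens_index m n)) /=.
  by apply: eq_bigr => -[].
exists (@mxtens_unindex m n) => x _; [exact: mxtens_indexK | exact: mxtens_unindexK].
Qed.

Lemma mxtensP m n p q (M N : 'M[K]_(m * p, n * q)) :
  (forall i k j l, M (mxtens_index (i, k)) (mxtens_index (j, l)) =
                   N (mxtens_index (i, k)) (mxtens_index (j, l))) -> M = N.
Proof.
move=> MN; apply/matrixP => r s.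
by case: (mxtens_indexP r) => i k; case: (mxtens_indexP s) => j l.
Qed.

Lemma tensmx11 m n : (1%:M : 'M[K]_m) *t (1%:M : 'M[K]_n) = 1%:M.
Proof.
apply: mxtensP => i k j l; rewrite tensmxE !mxE -natrM mulnb.
by rewrite (can_eq (@mxtens_indexK _ _)) xpair_eqE.
Qed.

Lemma tensmxZl m n p q c (A : 'M[K]_(m, n)) (B : 'M[K]_(p, q)) :
  (c *: A) *t B = c *: (A *t B).
Proof. by apply: mxtensP => i k j l; rewrite [RHS]mxE !tensmxE mxE mulrA. Qed.

Lemma tensmxZr m n p q c (A : 'M[K]_(m, n)) (B : 'M[K]_(p, q)) :
  A *t (c *: B) = c *: (A *t B).
Proof. by apply: mxtensP => i k j l; rewrite [RHS]mxE !tensmxE mxE mulrCA. Qed.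

Lemma tensmx_suml (I : Type) (r : seq I) m n p q (A : I -> 'M[K]_(m, n)) (B : 'M[K]_(p, q)) :
  (\sum_(i <- r) A i) *t B = \sum_(i <- r) (A i *t B).
Proof.
apply: mxtensP => i k j l; rewrite summxE tensmxE summxE mulr_suml.
by apply: eq_bigr => x _; rewrite tensmxE.
Qed.

Lemma mxtrace_tens1mx m n (A : 'M[K]_m) (M : 'M[K]_(m * n)) :
  \tr ((A *t 1%:M) *m M) =
  \sum_i \sum_j A i j * \sum_k M (mxtens_index (j, k)) (mxtens_index (i, k)).
Proof.
rewrite /mxtrace sum_mxtens_index; apply: eq_bigr => i _.
under [RHS]eq_bigr do rewrite mulr_sumr.
rewrite exchange_big; apply: eq_bigr => k _; rewrite mxE sum_mxtens_index.
apply: eq_bigr => j _; rewrite (bigD1 k) //= big1 => [|l lk].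
  by rewrite tensmxE mxE eqxx mulr1 addr0.
by rewrite tensmxE mxE eq_sym (negbTE lk) mulr0 mul0r.
Qed.

Lemma mxtrace_1tensmx m n (B : 'M[K]_n) (M : 'M[K]_(m * n)) :
  \tr ((1%:M *t B) *m M) =
  \sum_k \sum_l B k l * \sum_i M (mxtens_index (i, l)) (mxtens_index (i, k)).
Proof.
rewrite /mxtrace sum_mxtens_index exchange_big; apply: eq_bigr => k _.
under [RHS]eq_bigr do rewrite mulr_sumr.
rewrite [RHS]exchange_big; apply: eq_bigr => i _; rewrite mxE sum_mxtens_index.
rewrite (bigD1 i) //= [X in _ + X]big1 => [|j ji].
  by rewrite addr0; apply: eq_bigr => l _; rewrite tensmxE mxE eqxx mul1r.
by apply: big1 => l _; rewrite tensmxE mxE eq_sym (negbTE ji) !mul0r.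
Qed.

Lemma mxtrace_delta_mul n (M : 'M[K]_n) i j : \tr (delta_mx j i *m M) = M i j.
Proof.
rewrite -(mul_delta_mx (0 : 'I_1)) -mulmxA mxtrace_mulC -mulmxA.
by rewrite -colE -rowE trace_mx11 !mxE.
Qed.

Lemma eq_mxtrace_mul n (M N : 'M[K]_n) :
  (forall A, \tr (A *m M) = \tr (A *m N)) -> M = N.
Proof. by move=> MN; apply/matrixP => i j; rewrite -!mxtrace_delta_mul. Qed.

End TensorProduct.

Section Adjoint.
Variable R : realType.
Local Notation C := R[i].

Lemma adjmxE m n (A : 'M[C]_(m, n)) i j : adjmx A i j = conjc (A j i).
Proof. by rewrite !mxE. Qed.

Lemma adjmxK m n : cancel (@adjmx R m n) (@adjmx R n m).
Proof. by move=> A; apply/matrixP => i j; rewrite !adjmxE conjcK. Qed.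

Lemma adjmxM m n p (A : 'M[C]_(m, n)) (B : 'M[C]_(n, p)) :
  adjmx (A *m B) = adjmx B *m adjmx A.
Proof. by rewrite /adjmx map_mxM trmx_mul. Qed.

Lemma adjmx1 n : adjmx (1%:M : 'M[C]_n) = 1%:M.
Proof. by rewrite /adjmx map_mx1 trmx1. Qed.

Lemma adjmxB m n (A B : 'M[C]_(m, n)) : adjmx (A - B) = adjmx A - adjmx B.
Proof. by rewrite /adjmx map_mxB linearB. Qed.

Lemma adjmxZ m n c (A : 'M[C]_(m, n)) : adjmx (c *: A) = conjc c *: adjmx A.
Proof. by rewrite /adjmx map_mxZ linearZ. Qed.

Lemma adjmx_tens m n p q (A : 'M[C]_(m, n)) (B : 'M[C]_(p, q)) :
  adjmx (A *t B) = adjmx A *t adjmx B.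
Proof. by rewrite /adjmx map_mxT trmx_tens. Qed.

Lemma mxtrace_adj n (A : 'M[C]_n) : \tr (adjmx A) = conjc (\tr A).
Proof. by rewrite mxtrace_tr trace_map_mx. Qed.

Lemma mxtrace_mul_hermitian_real n (A B : 'M[C]_n) :
  adjmx A = A -> adjmx B = B -> \tr (A *m B) = (complex.Re (\tr (A *m B)))%:C.
Proof.
move=> A_herm B_herm; have := mxtrace_adj (A *m B).
rewrite adjmxM A_herm B_herm mxtrace_mulC.
case: (\tr _) => x y /= [] /eqP; rewrite -addr_eq0 -mulr2n mulrn_eq0 /=.
by move=> /eqP ->.
Qed.

Lemma adjmx_evolve n (A M : 'M[C]_n) :
  adjmx (evolve A M) = evolve A (adjmx M).
Proof. by rewrite !adjmxM adjmxK mulmxA. Qed.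

Lemma evolve_mulmx n (A B M : 'M[C]_n) :
  evolve (A *m B) M = evolve A (evolve B M).
Proof. by rewrite adjmxM !mulmxA. Qed.

Lemma mxtrace_mul_evolve n (A U M : 'M[C]_n) :
  \tr (A *m evolve U M) = \tr (adjmx U *m A *m U *m M).
Proof. by rewrite mulmxA mxtrace_mulC !mulmxA. Qed.

Lemma unitary1 n : unitary (1%:M : 'M[C]_n).
Proof. by split; rewrite adjmx1 mulmx1. Qed.

Lemma unitary_adj n (U : 'M[C]_n) : unitary U -> unitary (adjmx U).
Proof. by case=> UU' U'U; split; rewrite adjmxK. Qed.

Lemma unitaryM n (U V : 'M[C]_n) : unitary U -> unitary V -> unitary (U *m V).
Proof.
move=> [UU' U'U] [VV' V'V]; split; rewrite adjmxM mulmxA.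
  by rewrite -(mulmxA U) VV' mulmx1.
by rewrite -(mulmxA (adjmx V)) U'U mulmx1.
Qed.

Lemma mxtrace_evolve_unitary n (U M : 'M[C]_n) :
  unitary U -> \tr (evolve U M) = \tr M.
Proof. by move=> [_ U'U]; rewrite mxtrace_mulC mulmxA U'U mul1mx. Qed.

End Adjoint.

Section PartialTrace.
Variable R : realType.
Local Notation C := R[i].

Definition ptrS m n (M : 'M[C]_(m * n)) : 'M[C]_n :=
  \matrix_(k, l) \sum_(i < m) M (mxtens_index (i, k)) (mxtens_index (i, l)).

Lemma mxtrace_mul_ptrE (A : 'M[C]_2) (M : 'M[C]_(2 * 2)) :
  \tr (A *m ptrE M) = \tr ((A *t 1%:M) *m M).
Proof.
rewrite mxtrace_tens1mx; apply: eq_bigr => i _; rewrite mxE.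
by apply: eq_bigr => j _; rewrite mxE.
Qed.

Lemma mxtrace_mul_ptrS m n (B : 'M[C]_n) (M : 'M[C]_(m * n)) :
  \tr (B *m ptrS M) = \tr ((1%:M *t B) *m M).
Proof.
rewrite mxtrace_1tensmx; apply: eq_bigr => k _; rewrite mxE.
by apply: eq_bigr => l _; rewrite mxE.
Qed.

Lemma mxtrace_ptrE (M : 'M[C]_(2 * 2)) : \tr (ptrE M) = \tr M.
Proof. by rewrite -[ptrE M]mul1mx mxtrace_mul_ptrE tensmx11 mul1mx. Qed.

Lemma mxtrace_ptrS m n (M : 'M[C]_(m * n)) : \tr (ptrS M) = \tr M.
Proof. by rewrite -[ptrS M]mul1mx mxtrace_mul_ptrS tensmx11 mul1mx. Qed.

Lemma ptrEB (M N : 'M[C]_(2 * 2)) : ptrE (M - N) = ptrE M - ptrE N.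
Proof. by apply/matrixP => i j; rewrite !mxE -sumrB; apply: eq_bigr => k _; rewrite !mxE. Qed.

Lemma ptrSB m n (M N : 'M[C]_(m * n)) : ptrS (M - N) = ptrS M - ptrS N.
Proof. by apply/matrixP => i j; rewrite !mxE -sumrB; apply: eq_bigr => k _; rewrite !mxE. Qed.

Lemma ptrE_tens (A B : 'M[C]_2) : ptrE (A *t B) = \tr B *: A.
Proof.
by apply/matrixP => i j; rewrite !mxE mulr_suml; apply: eq_bigr => k _; rewrite tensmxE mulrC.
Qed.

Lemma ptrS_tens m n (A : 'M[C]_m) (B : 'M[C]_n) : ptrS (A *t B) = \tr A *: B.
Proof.
by apply/matrixP => k l; rewrite !mxE mulr_suml; apply: eq_bigr => i _; rewrite tensmxE.
Qed.

Lemma adj_ptrE (M : 'M[C]_(2 * 2)) : adjmx (ptrE M) = ptrE (adjmx M).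
Proof.
by apply/matrixP => i j; rewrite adjmxE !mxE rmorph_sum; apply: eq_bigr => k _; rewrite adjmxE.
Qed.

Lemma adj_ptrS m n (M : 'M[C]_(m * n)) : adjmx (ptrS M) = ptrS (adjmx M).
Proof.
by apply/matrixP => i j; rewrite adjmxE !mxE rmorph_sum; apply: eq_bigr => k _; rewrite adjmxE.
Qed.

Lemma ptrE_evolve_tens (A B : 'M[C]_2) (M : 'M[C]_(2 * 2)) : unitary B ->
  ptrE (evolve (A *t B) M) = evolve A (ptrE M).
Proof.
move=> [_ B'B]; apply: eq_mxtrace_mul => X.
rewrite mxtrace_mul_evolve !mxtrace_mul_ptrE mxtrace_mul_evolve.
by rewrite adjmx_tens !tensmx_mul mulmx1 B'B.
Qed.

Lemma ptrS_evolve_tens m n (A : 'M[C]_m) (B : 'M[C]_n) (M : 'M[C]_(m * n)) : unitary A ->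
  ptrS (evolve (A *t B) M) = evolve B (ptrS M).
Proof.
move=> [_ A'A]; apply: eq_mxtrace_mul => X.
rewrite mxtrace_mul_evolve !mxtrace_mul_ptrS mxtrace_mul_evolve.
by rewrite adjmx_tens !tensmx_mul mulmx1 A'A.
Qed.

Lemma quadratic_ptrS m n (M : 'M[C]_(m * n)) (v : 'cV[C]_n) :
  (adjmx v *m ptrS M *m v) 0 0 =
  \sum_i (adjmx ((delta_mx i 0 : 'cV_m) *t v) *m M *m ((delta_mx i 0 : 'cV_m) *t v)) 0 0.
Proof.
rewrite -trace_mx11 mxtrace_mulC mulmxA mxtrace_mul_ptrS mx1_sum_delta.
rewrite tensmx_suml mulmx_suml raddf_sum; apply: eq_bigr => i _ /=.
rewrite -trace_mx11 [RHS]mxtrace_mulC mulmxA; congr (\tr (_ *m _)).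
have adj_delta : adjmx (delta_mx i 0 : 'cV[C]_m) = delta_mx 0 i.
  by apply/matrixP => a b; rewrite adjmxE !mxE conjc_nat andbC.
rewrite -(mul_delta_mx (0 : 'I_1)) adjmx_tens adj_delta.
exact: esym (tensmx_mul (delta_mx i 0) v (delta_mx 0 i) (adjmx v)).
Qed.

Lemma density_ptrS m n (rho : 'M[C]_(m * n)) : density rho -> density (ptrS rho).
Proof.
case=> rho_herm rho_ge0 rho_tr; split.
- by rewrite adj_ptrS rho_herm.
- by move=> v; rewrite quadratic_ptrS; apply: sumr_ge0 => i _; exact: rho_ge0.
- by rewrite mxtrace_ptrS.
Qed.

End PartialTrace.

Section ImaginaryExponential.
Local Open Scope classical_set_scope.
Variable R : realType.
Local Notation C := R[i].

Definition cis (t : R) : C := cos t +i* sin t.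

Definition cvg_complex (u : nat -> C) (l : C) : Prop :=
  ((fun N => complex.Re (u N)) @ \oo --> (complex.Re l : R)) /\
  ((fun N => complex.Im (u N)) @ \oo --> (complex.Im l : R)).

Lemma cvg_complex_unique u k l : cvg_complex u k -> cvg_complex u l -> k = l.
Proof.
move=> [uRek uImk] [uRel uIml]; apply/eqP; rewrite eq_complex.
by rewrite (cvg_unique _ uRek uRel) // (cvg_unique _ uImk uIml) // !eqxx.
Qed.

Lemma cvg_complexD u v k l :
  cvg_complex u k -> cvg_complex v l -> cvg_complex (fun N => u N + v N) (k + l).
Proof.
have ReD (x y : C) : complex.Re (x + y) = complex.Re x + complex.Re y by case: x y => [? ?] [].
have ImD (x y : C) : complex.Im (x + y) = complex.Im x + complex.Im y by case: x y => [? ?] [].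
move=> [uRe uIm] [vRe vIm]; split.
  by rewrite ReD; under eq_fun do rewrite ReD; exact: cvgD.
by rewrite ImD; under eq_fun do rewrite ImD; exact: cvgD.
Qed.

Lemma cvg_complexMl u l c :
  cvg_complex u l -> cvg_complex (fun N => u N * c) (l * c).
Proof.
have ReM (x y : C) : complex.Re (x * y) =
  complex.Re x * complex.Re y - complex.Im x * complex.Im y by case: x y => [? ?] [].
have ImM (x y : C) : complex.Im (x * y) =
  complex.Re x * complex.Im y + complex.Im x * complex.Re y by case: x y => [? ?] [].
move=> [uRe uIm]; split.
  by rewrite ReM; under eq_fun do rewrite ReM; apply: cvgB; apply: cvgM => //; exact: cvg_cst.
by rewrite ImM; under eq_fun do rewrite ImM; apply: cvgD; apply: cvgM => //; exact: cvg_cst.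
Qed.

Lemma cvg_complex_sum (I : Type) (r : seq I) (u : I -> nat -> C) (l : I -> C) :
  (forall i, cvg_complex (u i) (l i)) ->
  cvg_complex (fun N => \sum_(i <- r) u i N) (\sum_(i <- r) l i).
Proof.
move=> ul; elim: r => [|i r IHr].
  by rewrite big_nil; under eq_fun do rewrite big_nil; split; exact: cvg_cst.
by rewrite big_cons; under eq_fun do rewrite big_cons; exact: cvg_complexD.
Qed.

Lemma imag_exp_coeff (x : R) m :
  (m`!)%:R^-1 * (0 +i* x) ^+ m = cos_coeff x m +i* sin_coeff x m.
Proof.
have -> : (0 +i* x) = 'i * x%:C :> C by simpc.
have -> : (m`!)%:R^-1 = ((m`!)%:R^-1 : R)%:C :> C by rewrite fmorphV rmorph_nat.
rewrite exprMn; have -> : 'i ^+ m = ((-1) ^+ m./2)%:C * 'i ^+ odd m :> C.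
  by rewrite -{1}(odd_double_half m) exprD -mul2n exprM sqr_i rmorphXn rmorphN1 mulrC.
rewrite -rmorphXn /cos_coeff /sin_coeff /= -exprnP.
case: (boolP (odd m)) => [m_odd|_]; last by simpc; congr (_ +i* _); ring.
have -> : m.-1./2 = m./2 by rewrite -{1}(odd_double_half m) m_odd /= doubleK.
by simpc; congr (_ +i* _); ring.
Qed.

Lemma cvg_imag_exp_series (x : R) :
  cvg_complex (fun N => \sum_(k < N) (k`!)%:R^-1 * (0 +i* x) ^+ k) (cis x).
Proof.
have partial_sum N : \sum_(k < N) (k`!)%:R^-1 * (0 +i* x) ^+ k =
    series (cos_coeff x) N +i* series (sin_coeff x) N.
  rewrite /series /=; elim: N => [|N IHN]; first by rewrite !big_nil big_ord0.
  by rewrite big_ord_recr IHN imag_exp_coeff !big_nat_recr.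
split; rewrite /cis /= ?cos.unlock ?sin.unlock.
  rewrite (_ : (fun N => _) = series (cos_coeff x)); first exact: is_cvg_series_cos_coeff.
  by apply/funext => N; rewrite partial_sum.
rewrite (_ : (fun N => _) = series (sin_coeff x)); first exact: is_cvg_series_sin_coeff.
by apply/funext => N; rewrite partial_sum.
Qed.

Lemma is_expmx_unique n (A E F : 'M[C]_n) : is_expmx A E -> is_expmx A F -> E = F.
Proof.
by move=> AE AF; apply/matrixP => i j; exact: cvg_complex_unique (AE i j) (AF i j).
Qed.

(* The [E j] need not be idempotent: all that is used is that their columns are
   joint eigenvectors of [A] and [F] and that they sum to [1]. *)
Definition spectral_exp n (A F : 'M[C]_n) : Prop :=
  exists (I : finType) (E : I -> 'M[C]_n) (x : I -> R),
    [/\ \sum_j E j = 1%:M,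
        forall j, A *m E j = (0 +i* x j) *: E j
      & forall j, F *m E j = cis (x j) *: E j].

Lemma spectral_exp_is_expmx n (A F : 'M[C]_n) : spectral_exp A F -> is_expmx A F.
Proof.
case=> I [E [x [sumE AE FE]]].
have mxpowE j k : mxpow A k *m E j = (0 +i* x j) ^+ k *: E j.
  elim: k => [|k IHk]; first by rewrite /mxpow mul1mx scale1r.
  by rewrite [mxpow A _]/(A *m mxpow A k) -mulmxA IHk -scalemxAr AE scalerA exprSr.
have expsumE N :
    expsum A N = \sum_j (\sum_(k < N) (k`!)%:R^-1 * (0 +i* x j) ^+ k) *: E j.
  rewrite -[expsum A N]mulmx1 -sumE mulmx_sumr; apply: eq_bigr => j _.
  rewrite /expsum mulmx_suml scaler_suml; apply: eq_bigr => k _.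
  by rewrite -scalemxAl mxpowE scalerA.
have FE_sum : F = \sum_j cis (x j) *: E j.
  by rewrite -[LHS]mulmx1 -sumE mulmx_sumr; exact: eq_bigr.
move=> a b; suff : cvg_complex (fun N => expsum A N a b) (F a b) by [].
rewrite FE_sum summxE; under eq_fun do rewrite expsumE summxE.
apply: cvg_complex_sum => j; rewrite mxE; under eq_fun do rewrite mxE.
exact/cvg_complexMl/cvg_imag_exp_series.
Qed.

Lemma spectral_exp0 n : spectral_exp (0 : 'M[C]_n) 1%:M.
Proof.
exists unit, (fun=> 1%:M), (fun=> 0).
split=> [|_|_]; first by rewrite big_const card_unit /= addr0.
  by rewrite mul0mx scale0r.
by rewrite /cis cos0 sin0 scale1r mulmx1.
Qed.

End ImaginaryExponential.

Lemma comm_mxZ (K : comNzRingType) n c (A B : 'M[K]_n) : comm_mx A B -> comm_mx A (c *: B).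
Proof. by rewrite /comm_mx -scalemxAr -scalemxAl => ->. Qed.

Section InvolutionExponential.
Variables (R : realType) (n : nat) (X : 'M[R[i]]_n).
Local Notation C := R[i].

(* [exp (- i t X)], provided that [X] is an involution *)
Definition involexp (t : R) : 'M[C]_n := (cos t)%:C%:M - ('i * (sin t)%:C) *: X.

Lemma involexp0 : involexp 0 = 1%:M.
Proof. by rewrite /involexp cos0 sin0 rmorph0 mulr0 scale0r subr0. Qed.

Lemma comm_involexp (Y : 'M[C]_n) t : comm_mx Y X -> comm_mx Y (involexp t).
Proof. by move=> YX; apply: comm_mxB; [exact: comm_mx_scalar | exact: comm_mxZ]. Qed.

Lemma mulmx_involexp (Y Z : 'M[C]_n) t :
  Y *m X = 'i *: Z -> Y *m involexp t = (cos t)%:C *: Y + (sin t)%:C *: Z.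
Proof.
move=> YX; rewrite mulmxBr mul_mx_scalar -scalemxAr YX scalerA mulrAC -expr2 sqr_i.
by rewrite mulN1r scaleNr opprK.
Qed.

Lemma involexp_anticomm (Y : 'M[C]_n) t :
  Y *m X = - (X *m Y) -> Y *m involexp t = involexp (- t) *m Y.
Proof.
move=> YX; rewrite mulmxBr mulmxBl -scalemxAr -scalemxAl YX.
by rewrite scalar_mxC cosN sinN rmorphN mulrN scaleNr scalerN.
Qed.

Hypothesis X_invol : X *m X = 1%:M.

Lemma involexpD s t : involexp s *m involexp t = involexp (s + t).
Proof.
rewrite mulmxBl !mulmxBr -scalar_mxM mul_scalar_mx mul_mx_scalar.
rewrite -scalemxAl -scalemxAr X_invol !scalerA scalemx1 /involexp cosD sinD.
have -> : 'i * (sin s)%:C * ('i * (sin t)%:C) = - ((sin s)%:C * (sin t)%:C) :> C.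
  by rewrite mulrACA -expr2 sqr_i mulN1r.
apply/matrixP => i j; rewrite !mxE rmorphB rmorphD !rmorphM /=.
by case: (i == j); rewrite ?mulr1n ?mulr0n; ring.
Qed.

Lemma involexpNK t : involexp (- t) *m involexp t = 1%:M.
Proof. by rewrite involexpD addNr involexp0. Qed.

Lemma involexp_eigen (b : bool) (E : 'M[C]_n) t :
  X *m E = (-1) ^+ b *: E -> involexp t *m E = cis (- ((-1) ^+ b * t)) *: E.
Proof.
move=> XE; rewrite mulmxBl mul_scalar_mx -scalemxAl XE scalerA -scalerBl; congr (_ *: _).
by rewrite /cis; case: b {XE}; rewrite ?expr0 ?expr1 ?mulN1r ?mul1r ?opprK ?cosN ?sinN; simpc.
Qed.

Lemma involexp_conj_comm (Y : 'M[C]_n) t :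
  comm_mx Y X -> involexp (- t) *m Y *m involexp t = Y.
Proof. by move=> YX; rewrite -mulmxA (comm_involexp t YX) mulmxA involexpNK mul1mx. Qed.

Lemma involexp_conj_anticomm (Y : 'M[C]_n) t :
  Y *m X = - (X *m Y) -> involexp (- t) *m Y *m involexp t = Y *m involexp (t *+ 2).
Proof.
by move=> YX; rewrite -(involexp_anticomm t YX) -mulmxA involexpD mulr2n.
Qed.

Hypothesis X_herm : adjmx X = X.

Lemma adj_involexp t : adjmx (involexp t) = involexp (- t).
Proof.
rewrite adjmxB adjmxZ X_herm -scalemx1 adjmxZ adjmx1 scalemx1 /involexp cosN sinN.
by congr (_%:M - _ *: _); simpc.
Qed.

Lemma unitary_involexp t : unitary (involexp t).
Proof. by split; rewrite adj_involexp ?involexpNK // -{1}(opprK t) involexpNK. Qed.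

End InvolutionExponential.

Lemma spectral_exp_involution (R : realType) n (A F X : 'M[R[i]]_n) (t : R) :
  X *m X = 1%:M -> comm_mx A X -> comm_mx F X ->
  spectral_exp A F -> spectral_exp (A - 'i * t%:C *: X) (involexp X t *m F).
Proof.
move=> X_invol AX FX [I [E [x [sumE AE FE]]]].
pose P (b : bool) : 'M[R[i]]_n := 2^-1 *: (1%:M + (-1) ^+ b *: X).
have XP b : X *m P b = (-1) ^+ b *: P b.
  rewrite -scalemxAr mulmxDr mulmx1 -scalemxAr X_invol scalerA mulrC -scalerA; congr (_ *: _).
  by rewrite scalerDr scalerA -expr2 sqrr_sign scale1r addrC.
have comm_P B b : comm_mx B X -> B *m P b = P b *m B.
  by move=> BX; apply/comm_mxZ/comm_mxD; [exact: comm_mx1 | exact: comm_mxZ].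
have sumP : P true + P false = 1%:M.
  rewrite /P -scalerDr scaleN1r scale1r addrACA addNr addr0 -mulr2n -[1%:M *+ 2]scaler_nat.
  by rewrite scalerA mulVf ?pnatr_eq0 // scale1r.
clearbody P; exists (I * bool)%type, (fun jb : I * bool => P jb.2 *m E jb.1),
  (fun jb : I * bool => x jb.1 - (-1) ^+ jb.2 * t).
split=> [|[j b]|[j b]] /=.
- rewrite -(pair_bigA _ (fun j b => P b *m E j)) /= -sumE; apply: eq_bigr => j _.
  by rewrite big_bool /= -mulmxDl sumP mul1mx.
- rewrite mulmxBl mulmxA comm_P // -mulmxA AE -scalemxAl (mulmxA X) XP.
  rewrite -scalemxAr -scalemxAl scalerA -scalerBl; congr (_ *: _).
  by case: b; rewrite ?expr0 ?expr1 ?mulN1r ?mul1r ?opprK; simpc.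
- rewrite -mulmxA (mulmxA F) comm_P // -(mulmxA (P b)) FE -!scalemxAr mulmxA.
  rewrite (involexp_eigen _ (XP b)) -scalemxAl scalerA; congr (_ *: _).
  by rewrite [RHS]/cis cosD sinD /cis; simpc; congr (_ +i* _); ring.
Qed.

Lemma is_expmx_involutions (R : realType) n (I : Type) (X : I -> 'M[R[i]]_n) (a : I -> R) s :
  (forall j, X j *m X j = 1%:M) -> (forall j k, comm_mx (X j) (X k)) ->
  is_expmx (- 'i *: \sum_(j <- s) (a j)%:C *: X j)
           (\big[mulmx/1%:M]_(j <- s) involexp (X j) (a j)).
Proof.
move=> X_invol Xcomm; apply: spectral_exp_is_expmx; elim: s => [|k s IHs].
  by rewrite !big_nil scaler0; exact: spectral_exp0.
rewrite !big_cons scalerDr addrC [X in _ + X]scalerA mulNr [X in _ + X]scaleNr.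
apply: spectral_exp_involution => //.
  by apply/comm_mx_sym/comm_mxZ/comm_mx_sum => j _; exact: comm_mxZ.
apply: comm_mx_sym; elim/big_ind: _ => [|A B|j _].
- exact: comm_mx1.
- exact: comm_mxM.
- exact: comm_involexp.
Qed.

Section SmallIndices.

Lemma ord2P (P : 'I_2 -> Prop) : P 0 -> P 1 -> forall j, P j.
Proof.
move=> P0 P1 [[|[|//]] lt2].
  by rewrite (_ : Ordinal _ = 0) //; apply: val_inj.
by rewrite (_ : Ordinal _ = 1) //; apply: val_inj.
Qed.

Lemma sum_ord2 (V : nmodType) (F : 'I_2 -> V) : \sum_j F j = F 0 + F 1.
Proof. by rewrite big_ord_recl big_ord1; congr (_ + F _); apply: val_inj. Qed.

Lemma matrix2P (T : Type) (A B : 'M[T]_2) :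
  A 0 0 = B 0 0 -> A 0 1 = B 0 1 -> A 1 0 = B 1 0 -> A 1 1 = B 1 1 -> A = B.
Proof. by move=> *; apply/matrixP; apply: ord2P; apply: ord2P. Qed.

Lemma ord3_add : ((1 + 1 = 2 :> 'I_3)%R * (1 + 2 = 0 :> 'I_3)%R *
  (2 + 1 = 0 :> 'I_3)%R * (2 + 2 = 1 :> 'I_3)%R)%type.
Proof. by do !split; apply: val_inj. Qed.

Lemma ord3_cycleP (k : 'I_3) (P : 'I_3 -> Prop) :
  P k -> P (k + 1) -> P (k + 2) -> forall j, P j.
Proof.
move=> Pk Pk1 Pk2 j.
have /or3P[/eqP->|/eqP->|/eqP->] // : [|| j == k, j == k + 1 | j == k + 2].
by move: k j {Pk Pk1 Pk2} => [[|[|[|//]]] ?] [[|[|[|//]]] ?].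
Qed.

Lemma ord3_cycle_neq (k : 'I_3) :
  (((k + 1 == k) = false)%R * ((k + 2 == k) = false)%R * ((k == k + 1) = false)%R *
   ((k == k + 2) = false)%R * ((k + 1 == k + 2) = false)%R * ((k + 2 == k + 1) = false)%R)%type.
Proof. by move: k => [[|[|[|//]]] ?]. Qed.

Lemma ord3P (P : 'I_3 -> Prop) : P 0 -> P 1 -> P 2 -> forall j, P j.
Proof. by move=> P0 P1 P2; apply: (@ord3_cycleP 0); rewrite ?add0r. Qed.

Lemma sum_ord3_cycle (V : nmodType) (k : 'I_3) (F : 'I_3 -> V) :
  \sum_j F j = F k + F (k + 1) + F (k + 2).
Proof.
have sum3 : \sum_j F j = F 0 + F 1 + F 2.
  rewrite !big_ord_recl big_ord0 addr0 addrA.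
  by congr (_ + F _ + F _); apply: val_inj.
move: k; apply: ord3P; rewrite ?add0r ?ord3_add sum3 //.
  by rewrite [RHS]addrC addrA.
by rewrite -[RHS]addrA addrC.
Qed.

End SmallIndices.

Section Pauli.
Variable R : realType.
Local Notation C := R[i].
Local Notation pauli := (@pauli R).

Lemma adj_pauli k : adjmx (pauli k) = pauli k.
Proof.
by move: k; apply: ord3P; apply: matrix2P; rewrite adjmxE !mxE /=; simpc.
Qed.

Lemma pauliK k : pauli k *m pauli k = 1%:M.
Proof.
by move: k; apply: ord3P; apply: matrix2P; rewrite !mxE sum_ord2 !mxE /=; simpc.
Qed.

Lemma pauliM k :
  ((pauli k *m pauli (k + 1) = 'i *: pauli (k + 2))%R *
   (pauli (k + 1) *m pauli (k + 2) = 'i *: pauli k)%R *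
   (pauli (k + 2) *m pauli k = 'i *: pauli (k + 1))%R *
   (pauli (k + 1) *m pauli k = - 'i *: pauli (k + 2))%R *
   (pauli (k + 2) *m pauli (k + 1) = - 'i *: pauli k)%R *
   (pauli k *m pauli (k + 2) = - 'i *: pauli (k + 1))%R)%type.
Proof.
have next j : pauli j *m pauli (j + 1) = 'i *: pauli (j + 2).
  by move: j; apply: ord3P; apply: matrix2P; rewrite !mxE sum_ord2 !mxE /=; simpc.
have prev j : pauli (j + 1) *m pauli j = - 'i *: pauli (j + 2).
  by rewrite -[LHS]adjmxK adjmxM !adj_pauli next adjmxZ adj_pauli; simpc.
have := (next (k + 1), next (k + 2), prev (k + 1), prev (k + 2)).
by rewrite -!addrA !ord3_add !addr0 => -[[[]]].
Qed.

Lemma pauli_anticomm j k : j != k -> pauli j *m pauli k = - (pauli k *m pauli j).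
Proof.
move: j; apply: (ord3_cycleP (k := k)) => [|_|_]; first by rewrite eqxx.
  by rewrite !pauliM scaleNr.
by rewrite !pauliM scaleNr opprK.
Qed.

Lemma mxtrace_pauli k : \tr (pauli k) = 0.
Proof.
by move: k; apply: ord3P; rewrite /mxtrace sum_ord2 !mxE /=; simpc; rewrite ?subrr.
Qed.

Lemma mxtrace_pauliM j k : \tr (pauli j *m pauli k) = (j == k)%:R * 2.
Proof.
move: j; apply: (ord3_cycleP (k := k)); first by rewrite pauliK mxtrace1 eqxx mul1r.
  by rewrite pauliM linearZ /= mxtrace_pauli ord3_cycle_neq mulr0 mul0r.
by rewrite pauliM linearZ /= mxtrace_pauli ord3_cycle_neq mulr0 mul0r.
Qed.

Lemma pauli_expand (N : 'M[C]_2) : \tr N = 0 ->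
  N = \sum_k (2^-1 * \tr (pauli k *m N)) *: pauli k.
Proof.
rewrite {1}/mxtrace sum_ord2 => /eqP; rewrite addrC addr_eq0 => /eqP trN.
have two_neq0 : (2 : C) != 0 by rewrite pnatr_eq0.
have i_sqr : 'i%C * 'i%C = -1 :> C by rewrite -expr2 sqr_i.
apply: matrix2P; rewrite (sum_ord3_cycle 0) !add0r !mxE /mxtrace !sum_ord2 !mxE !sum_ord2 !mxE.
all: rewrite /= ?trN -?complexiE; move: 'i%C i_sqr (N 0 0) (N 0 1) (N 1 0) => I i_sqr x y z.
- by field.
- transitivity (2^-1 * (y * (1 - I * I) + z * (1 + I * I))); first by rewrite i_sqr; field.
  by ring.
- transitivity (2^-1 * (y * (1 + I * I) + z * (1 - I * I))); first by rewrite i_sqr; field.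
  by ring.
- by field.
Qed.

Lemma pauli_basis_ext (N : 'M[C]_2) :
  \tr N = 0 -> (forall k, \tr (pauli k *m N) = 0) -> N = 0.
Proof.
move=> trN0 trP0; rewrite (pauli_expand trN0) big1 // => k _.
by rewrite trP0 mulr0 scale0r.
Qed.

End Pauli.

Section GivensRotations.
Variable R : realType.

Lemma givens_mul p q (t : R) n (T : 'M_(3, n)) i j : p != q ->
  (givens p q t *m T) i j =
  if i == p then cos t * T p j - sin t * T q j
  else if i == q then sin t * T p j + cos t * T q j
  else T i j.
Proof.
move=> pq; rewrite mxE; have qp : q == p = false by rewrite eq_sym (negbTE pq).
have [->|ip] := eqVneq i p.
  rewrite (bigD1 p) // (bigD1 q) //= ?qp // big1 => [|r /andP[rp rq]].
    by rewrite !mxE !eqxx (negbTE pq) addr0 mulNr.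
  by rewrite !mxE !eqxx [p == r]eq_sym (negbTE rp) (negbTE rq) (negbTE pq) mul0r.
have [->|iq] := eqVneq i q.
  rewrite (bigD1 p) // (bigD1 q) //= ?qp // big1 => [|r /andP[rp rq]].
    by rewrite !mxE !eqxx qp orbT /= addr0.
  by rewrite !mxE !eqxx [q == r]eq_sym (negbTE rp) (negbTE rq) qp mul0r.
rewrite (bigD1 i) //= big1 => [|r ri].
  by rewrite !mxE eqxx (negbTE ip) (negbTE iq) mul1r addr0.
by rewrite !mxE [i == r]eq_sym (negbTE ri) (negbTE ip) (negbTE iq) mul0r.
Qed.

Lemma givens_swap p q (t : R) : p != q -> givens q p t = givens p q (- t).
Proof.
move=> pq; apply/matrixP => i j; rewrite !mxE cosN sinN opprK orbC.
case: (i == j) => //; have [->|] := eqVneq i p; last by rewrite andbC.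
by rewrite (negbTE pq).
Qed.

Lemma cos_sin_root (a b : R) : exists t, a * cos t + b * sin t = 0.
Proof.
have [->|b0] := eqVneq b 0.
  by exists (pi / 2); rewrite cos_pihalf mulr0 mul0r addr0.
exists (atan (- (a / b))); have cos0 : cos (atan (- (a / b))) != 0.
  by rewrite gt_eqF // cos_gt0_pihalf // atan_gtNpi2 atan_ltpi2.
rewrite -[sin _](divfK cos0) -/(tan _) atanK.
by field.
Qed.

Lemma givens_linear_root p q n (T : 'M[R]_(3, n)) i j a b : p != q ->
  exists t, a * (givens p q t *m T) p i + b * (givens p q t *m T) q j = 0.
Proof.
move=> pq; have [t root_t] := cos_sin_root (a * T p i + b * T q j) (b * T p j - a * T q i).
exists t; rewrite !givens_mul // !eqxx eq_sym (negbTE pq) -[RHS]root_t.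
by ring.
Qed.

Lemma givens_align p q n (T : 'M[R]_(3, n)) j : p != q ->
  exists t, (givens p q t *m T) p j = 0 /\ 0 <= (givens p q t *m T) q j.
Proof.
move=> pq; have [t] := givens_linear_root T j j 1 0 pq.
rewrite mul1r mul0r addr0 => root_t.
have [ge0|lt0] := leP 0 ((givens p q t *m T) q j); first by exists t.
exists (t + pi); move: root_t lt0; rewrite !givens_mul // !eqxx eq_sym (negbTE pq).
rewrite cosDpi sinDpi !mulNr -!opprD oppr_ge0 => -> /ltW lt0.
by rewrite oppr0.
Qed.

Definition is_givens (g : 'I_3 * 'I_3 * R) : bool := g.1.1 != g.1.2.

Definition givens_word (gs : seq ('I_3 * 'I_3 * R)) : 'M[R]_3 :=
  \prod_(g <- gs) givens g.1.1 g.1.2 g.2.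

Lemma givens_word_cons p q t gs :
  givens_word ((p, q, t) :: gs) = givens p q t *m givens_word gs.
Proof. exact: big_cons. Qed.

Lemma givens_word_nil : givens_word [::] = 1%:M.
Proof. exact: big_nil. Qed.

Lemma exists_givens_word_lower_triangular (T : 'M[R]_3) : exists2 gs, all is_givens gs &
  [/\ is_trig_mx (givens_word gs *m T), 0 <= (givens_word gs *m T) 1 1
    & 0 <= (givens_word gs *m T) 2 2].
Proof.
have [t1 [T1_02 _]] : exists t, (givens 0 1 t *m T) 0 2 = 0 /\ 0 <= (givens 0 1 t *m T) 1 2.
  exact: givens_align.
set T1 := givens 0 1 t1 *m T in T1_02 *.
have [t2 [T2_12 T2_22]] :
    exists t, (givens 1 2 t *m T1) 1 2 = 0 /\ 0 <= (givens 1 2 t *m T1) 2 2.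
  exact: givens_align.
have T2_02 : (givens 1 2 t2 *m T1) 0 2 = 0 by rewrite givens_mul.
set T2 := givens 1 2 t2 *m T1 in T2_12 T2_22 T2_02 *.
have [t3 [T3_01 T3_11]] :
    exists t, (givens 0 1 t *m T2) 0 1 = 0 /\ 0 <= (givens 0 1 t *m T2) 1 1.
  exact: givens_align.
exists [:: (0, 1, t3); (1, 2, t2); (0, 1, t1)] => //.
have -> : givens_word [:: (0, 1, t3); (1, 2, t2); (0, 1, t1)] *m T = givens 0 1 t3 *m T2.
  by rewrite !givens_word_cons givens_word_nil mulmx1 -!mulmxA.
split=> //; last by rewrite givens_mul.
apply/is_trig_mxP; apply: ord3P; apply: ord3P => // _.
- by rewrite givens_mul // T2_02 T2_12 !mulr0 subr0.
- by rewrite givens_mul // T2_02 T2_12 !mulr0 addr0.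
Qed.

Lemma exists_givens_word_clear_row k l m (T : 'M[R]_3) a b : k != l -> l != m -> m != k ->
  exists2 gs, all is_givens gs &
  [/\ (givens_word gs *m T) k l = 0, (givens_word gs *m T) k m = 0
    & a * (givens_word gs *m T) l m + b * (givens_word gs *m T) m l = 0].
Proof.
move=> kl lm mk; have [lk km] : l != k /\ k != m by rewrite [l == k]eq_sym [k == m]eq_sym.
have [t1] := givens_linear_root T l l 1 0 kl.
rewrite mul1r mul0r addr0; set T1 := givens k l t1 *m T => T1_kl.
have [t2] := givens_linear_root T1 l l 0 1 lm.
rewrite mul1r mul0r add0r; set T2 := givens l m t2 *m T1 => T2_ml.
have T2_kl : T2 k l = 0 by rewrite givens_mul // (negbTE kl) (negbTE km).
have [t3] := givens_linear_root T2 m m 0 1 mk.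
rewrite mul1r mul0r add0r; set T3 := givens m k t3 *m T2 => T3_km.
have T3_kl : T3 k l = 0.
  by rewrite givens_mul // (negbTE km) eqxx T2_ml T2_kl !mulr0 addr0.
have [t4 T4_lm_ml] := givens_linear_root T3 m l a b lm.
exists [:: (l, m, t4); (m, k, t3); (l, m, t2); (k, l, t1)].
  by rewrite /= /is_givens /= kl lm mk.
have -> : givens_word [:: (l, m, t4); (m, k, t3); (l, m, t2); (k, l, t1)] *m T =
    givens l m t4 *m T3.
  by rewrite !givens_word_cons givens_word_nil mulmx1 -!mulmxA.
by split=> //; rewrite givens_mul // (negbTE kl) (negbTE km).
Qed.

End GivensRotations.

Section BlochRotations.
Variable R : realType.
Local Notation C := R[i].
Local Notation pauli := (@pauli R).
Local Notation to_complex := (map_mx (real_complex R)).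

Lemma rotOE (V : 'M[C]_2) a b : rotO V a b = 2^-1 * \tr (pauli a *m evolve V (pauli b)).
Proof. by rewrite mxE !mulmxA. Qed.

Lemma evolve_pauli (V : 'M[C]_2) b : unitary V ->
  evolve V (pauli b) = \sum_a rotO V a b *: pauli a.
Proof.
move=> uV; have tr0 : \tr (evolve V (pauli b)) = 0.
  by rewrite mxtrace_evolve_unitary // mxtrace_pauli.
by rewrite [LHS](pauli_expand tr0); apply: eq_bigr => a _; rewrite rotOE.
Qed.

Lemma rotO_eq (V : 'M[C]_2) (O : 'M[C]_3) :
  (forall b, evolve V (pauli b) = \sum_a O a b *: pauli a) -> rotO V = O.
Proof.
move=> V_pauli; apply/matrixP => a b; rewrite rotOE V_pauli mulmx_sumr.
rewrite raddf_sum (bigD1 a) //= big1 => [|c ca].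
  rewrite -scalemxAr linearZ /= mxtrace_pauliM eqxx mul1r addr0 mulrC mulfK //.
  by rewrite pnatr_eq0.
by rewrite -scalemxAr linearZ /= mxtrace_pauliM eq_sym (negbTE ca) mul0r mulr0.
Qed.

Lemma rotO_eq1 (V : 'M[C]_2) :
  (forall b, evolve V (pauli b) = pauli b) -> rotO V = 1%:M.
Proof.
move=> Vfix; apply: rotO_eq => b; rewrite Vfix (bigD1 b) //= big1 => [|a ab].
  by rewrite mxE eqxx scale1r addr0.
by rewrite mxE (negbTE ab) scale0r.
Qed.

Lemma rotO1 : rotO 1%:M = 1%:M :> 'M[C]_3.
Proof. by apply: rotO_eq1 => b; rewrite adjmx1 mul1mx mulmx1. Qed.

Lemma rotOM (V W : 'M[C]_2) : unitary V -> unitary W -> rotO (V *m W) = rotO V *m rotO W.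
Proof.
move=> uV uW; apply: rotO_eq => c; rewrite evolve_mulmx evolve_pauli //.
rewrite mulmx_sumr mulmx_suml.
under eq_bigr => b _.
  rewrite -scalemxAr -scalemxAl evolve_pauli // scaler_sumr.
  under eq_bigr do rewrite scalerA mulrC.
  over.
by rewrite exchange_big; apply: eq_bigr => a _; rewrite -scaler_suml mxE.
Qed.

Lemma rotO_adj (V : 'M[C]_2) : rotO (adjmx V) = (rotO V)^T.
Proof.
apply/matrixP => a b; rewrite [RHS]mxE !rotOE mxtrace_mul_evolve adjmxK; congr (_ * _).
by rewrite mxtrace_mulC.
Qed.

Lemma rotO_real (V : 'M[C]_2) : exists O, rotO V = to_complex O.
Proof.
exists (\matrix_(a, b) (2^-1 * complex.Re (\tr (pauli a *m evolve V (pauli b))))).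
apply/matrixP => a b; rewrite rotOE mxtrace_mul_hermitian_real ?adj_pauli //.
  by rewrite [RHS]mxE [in RHS]mxE rmorphM fmorphV rmorph_nat.
by rewrite adjmx_evolve adj_pauli.
Qed.

Definition pauli_rotation k (t : R) : 'M[C]_2 := involexp (pauli k) (t / 2).

Lemma unitary_pauli_rotation k t : unitary (pauli_rotation k t).
Proof. by apply: unitary_involexp; [exact: pauliK | exact: adj_pauli]. Qed.

Lemma pauli_rotation_evolve j k t (Z : 'M[C]_2) :
  j != k -> pauli j *m pauli k = 'i *: Z ->
  evolve (pauli_rotation k t) (pauli j) =
  (cos t)%:C *: pauli j - (sin t)%:C *: Z.
Proof.
move=> jk jkZ; rewrite /pauli_rotation adj_involexp ?adj_pauli // -{1}[t / 2]opprK.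
rewrite involexp_conj_anticomm ?pauliK //; last exact: pauli_anticomm.
rewrite (_ : - (t / 2) *+ 2 = - t); last by field.
by rewrite (mulmx_involexp _ jkZ) cosN sinN rmorphN scaleNr.
Qed.

Lemma rotO_pauli_rotation k t :
  rotO (pauli_rotation k t) = to_complex (givens (k + 1) (k + 2) t).
Proof.
apply: rotO_eq; apply: (ord3_cycleP (k := k)); rewrite (sum_ord3_cycle k) !mxE.
all: rewrite ?eqxx !ord3_cycle_neq /= ?rmorph0 ?rmorph1 ?rmorphN !scale0r ?scale1r.
- rewrite !addr0 /pauli_rotation adj_involexp ?adj_pauli // -{1}[t / 2]opprK.
  by rewrite involexp_conj_comm ?pauliK.
- rewrite add0r (@pauli_rotation_evolve _ _ _ (- pauli (k + 2))) ?ord3_cycle_neq //.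
    by rewrite scalerN opprK.
  by rewrite pauliM scaleNr scalerN.
- rewrite add0r (@pauli_rotation_evolve _ _ _ (pauli (k + 1))) ?ord3_cycle_neq ?pauliM //.
  by rewrite scaleNr addrC.
Qed.

Lemma givens_unitary_lift p q t : p != q ->
  exists2 V, unitary V & rotO V = to_complex (givens p q t).
Proof.
move: q; apply: (ord3_cycleP (k := p)); first by rewrite eqxx.
  exists (pauli_rotation (p + 2) t); first exact: unitary_pauli_rotation.
  by rewrite rotO_pauli_rotation -!addrA !ord3_add addr0.
move=> pq; exists (pauli_rotation (p + 1) (- t)); first exact: unitary_pauli_rotation.
by rewrite rotO_pauli_rotation -!addrA !ord3_add addr0 -givens_swap // eq_sym.
Qed.

Lemma givens_word_unitary_lift gs : all (@is_givens R) gs ->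
  exists2 V, unitary V & rotO V = to_complex (givens_word gs).
Proof.
elim: gs => [_|[[p q] t] gs IHgs /= /andP[/givens_unitary_lift-/(_ t)[V uV OV] /IHgs[W uW OW]]].
  by exists 1%:M; [exact: unitary1 | rewrite rotO1 givens_word_nil map_mx1].
exists (V *m W); first exact: unitaryM.
by rewrite rotOM // OV OW givens_word_cons map_mxM.
Qed.

End BlochRotations.

Section GivensProduct.
Variable R : realType.
Local Notation C := R[i].
Local Notation pauli := (@pauli R).
Local Notation to_complex := (map_mx (real_complex R)).

Lemma orthogonal_lower_triangular (N : 'M[R]_3) :
  N *m N^T = 1%:M -> is_trig_mx N -> 0 <= N 1 1 -> 0 <= N 2 2 ->
  col 1 N = delta_mx 1 0 /\ col 2 N = delta_mx 2 0.
Proof.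
move=> NNt /is_trig_mxP Ntrig N11_ge0 N22_ge0.
have [N01 N02 N12] : [/\ N 0 1 = 0, N 0 2 = 0 & N 1 2 = 0] by split; exact: Ntrig.
have rows i j : N i 0 * N j 0 + N i 1 * N j 1 + N i 2 * N j 2 = (i == j)%:R.
  have /matrixP/(_ i j) := NNt; rewrite [RHS]mxE => <-.
  by rewrite mxE (sum_ord3_cycle 0) !add0r !mxE.
have N00 : N 0 0 != 0.
  have := rows 0 0; rewrite N01 N02 !mulr0 !addr0 => N00; apply: contra_eq_neq N00 => ->.
  by rewrite mulr0 eq_sym oner_eq0.
have N10 : N 1 0 = 0.
  have := rows 1 0; rewrite N01 N02 !mulr0 !addr0 => /eqP.
  by rewrite mulf_eq0 (negbTE N00) orbF => /eqP.
have N20 : N 2 0 = 0.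
  have := rows 2 0; rewrite N01 N02 !mulr0 !addr0 => /eqP.
  by rewrite mulf_eq0 (negbTE N00) orbF => /eqP.
have sqr_eq1 (x : R) : 0 <= x -> x * x = 1 -> x = 1.
  by move=> x_ge0 xx; apply/eqP; rewrite -(@pexpr_eq1 _ x 2) // expr2 xx.
have N11 : N 1 1 = 1.
  by apply: sqr_eq1 => //; have := rows 1 1; rewrite N10 N12 !mul0r add0r addr0.
have N21 : N 2 1 = 0.
  by have := rows 2 1; rewrite N10 N12 N11 !mulr0 add0r addr0 mulr1.
have N22 : N 2 2 = 1.
  by apply: sqr_eq1 => //; have := rows 2 2; rewrite N20 N21 !mul0r !add0r.
by split; apply/matrixP => i j; rewrite !mxE ord1 eqxx andbT; move: i; apply: ord3P.
Qed.

Lemma rotO_lower_triangular_eq1 (B : 'M[C]_2) (N : 'M[R]_3) : unitary B ->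
  rotO B = to_complex N -> is_trig_mx N -> 0 <= N 1 1 -> 0 <= N 2 2 -> rotO B = 1%:M.
Proof.
move=> uB OB Ntrig N11 N22.
have NNt : N *m N^T = 1%:M.
  apply: (@map_mx_inj _ _ (real_complex R)); rewrite map_mxM -map_trmx map_mx1 -OB -rotO_adj.
  rewrite -rotOM //; last exact: unitary_adj.
  by case: uB => -> _; exact: rotO1.
have fixed b : col b N = delta_mx b 0 -> evolve B (pauli b) = pauli b.
  move=> /colP Nb; rewrite evolve_pauli // OB (bigD1 b) //= big1 => [|a ab].
    by have := Nb b; rewrite !mxE !eqxx => ->; rewrite rmorph1 scale1r addr0.
  by have := Nb a; rewrite !mxE (negbTE ab) => ->; rewrite rmorph0 scale0r.
have [col1 col2] := orthogonal_lower_triangular NNt Ntrig N11 N22.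
have fixed0 : evolve B (pauli 0) = pauli 0.
  have P12 : pauli 1 *m pauli 2 = 'i *: pauli 0 by have := pauliM R 0; rewrite !add0r => ->.
  have -> : pauli 0 = - 'i *: (pauli 1 *m pauli 2).
    by rewrite P12 scalerA mulNr -expr2 sqr_i opprK scale1r.
  rewrite -scalemxAr -scalemxAl; congr (_ *: _).
  rewrite -[in RHS](fixed 1 col1) -[in RHS](fixed 2 col2) -!mulmxA (mulmxA (adjmx B) B).
  by case: uB => _ ->; rewrite mul1mx.
by apply: rotO_eq1; apply: ord3P; [exact: fixed0 | exact: fixed col1 | exact: fixed col2].
Qed.

Lemma givens_product_rotO (V : 'M[C]_2) : unitary V -> givens_product (rotO V).
Proof.
move=> uV; have uV' := unitary_adj uV; have [T OV'] := rotO_real (adjmx V).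
have [gs gsP [Ntrig N11 N22]] := exists_givens_word_lower_triangular T.
have [W uW OW] := givens_word_unitary_lift gsP.
have OWV' : rotO (W *m adjmx V) = to_complex (givens_word gs *m T).
  by rewrite rotOM // OW OV' map_mxM.
exists gs; split; first exact: gsP.
rewrite -[RHS]/(to_complex (givens_word gs)) -OW.
have uWV' := unitaryM uW uV'.
have OWV'1 := rotO_lower_triangular_eq1 uWV' OWV' Ntrig N11 N22.
rewrite -[LHS]mul1mx -OWV'1 -rotOM // -mulmxA.
by case: uV => _ ->; rewrite mulmx1.
Qed.

End GivensProduct.

Section PauliPairs.
Variable R : realType.
Local Notation C := R[i].
Local Notation pauli := (@pauli R).

Definition pauli_pair k : 'M[C]_(2 * 2) := pauli k *t pauli k.

Lemma pauli_pairK k : pauli_pair k *m pauli_pair k = 1%:M.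
Proof. by rewrite tensmx_mul pauliK tensmx11. Qed.

Lemma adj_pauli_pair k : adjmx (pauli_pair k) = pauli_pair k.
Proof. by rewrite adjmx_tens adj_pauli. Qed.

Lemma pauli_pair_comm j k : comm_mx (pauli_pair j) (pauli_pair k).
Proof.
have [->|jk] := eqVneq j k; first exact: comm_mx_refl.
rewrite /comm_mx !tensmx_mul pauli_anticomm // -scaleN1r tensmxZl tensmxZr scalerA.
by rewrite mulrNN mulr1 scale1r.
Qed.

Lemma pauli_system_comm k : comm_mx (pauli k *t 1%:M) (pauli_pair k).
Proof. by rewrite /comm_mx !tensmx_mul mul1mx mulmx1. Qed.

Lemma pauli_system_anticomm j k : j != k ->
  (pauli j *t 1%:M) *m pauli_pair k = - (pauli_pair k *m (pauli j *t 1%:M)).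
Proof.
move=> jk; rewrite !tensmx_mul mul1mx mulmx1 pauli_anticomm //.
by rewrite -scaleN1r tensmxZl scaleN1r.
Qed.

End PauliPairs.

Section Correlations.
Variable R : realType.
Local Notation C := R[i].
Local Notation pauli := (@pauli R).
Local Notation to_complex := (map_mx (real_complex R)).

Definition correlation (M : 'M[C]_(2 * 2)) : 'M[C]_3 :=
  \matrix_(i, j) \tr ((pauli i *t pauli j) *m M).

Lemma correlation_real (M : 'M[C]_(2 * 2)) :
  adjmx M = M -> exists T, correlation M = to_complex T.
Proof.
move=> M_herm; exists (\matrix_(i, j) complex.Re (correlation M i j)).
apply/matrixP => i j; rewrite [RHS]mxE [in RHS]mxE mxE.
by apply: mxtrace_mul_hermitian_real; rewrite // adjmx_tens !adj_pauli.
Qed.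

Lemma correlation_evolve_system (V : 'M[C]_2) (M : 'M[C]_(2 * 2)) : unitary V ->
  correlation (evolve (V *t 1%:M) M) = rotO V *m correlation M.
Proof.
move=> uV; apply/matrixP => i j; rewrite mxE [RHS]mxE.
have := evolve_pauli i (unitary_adj uV); rewrite adjmxK rotO_adj => V_pauli.
rewrite mxtrace_mul_evolve adjmx_tens adjmx1 !tensmx_mul mul1mx mulmx1 V_pauli.
rewrite tensmx_suml mulmx_suml raddf_sum; apply: eq_bigr => a _ /=.
by rewrite tensmxZl -scalemxAl linearZ /= !mxE.
Qed.

Definition correlation_part (rho : 'M[C]_(2 * 2)) : 'M[C]_(2 * 2) :=
  rho - ptrE rho *t ptrS rho.

Lemma adj_correlation_part rho :
  adjmx rho = rho -> adjmx (correlation_part rho) = correlation_part rho.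
Proof. by move=> rho_herm; rewrite adjmxB adjmx_tens adj_ptrE adj_ptrS rho_herm. Qed.

Lemma ptrE_correlation_part rho : \tr rho = 1 -> ptrE (correlation_part rho) = 0.
Proof. by move=> tr1; rewrite ptrEB ptrE_tens mxtrace_ptrS tr1 scale1r subrr. Qed.

Lemma ptrS_correlation_part rho : \tr rho = 1 -> ptrS (correlation_part rho) = 0.
Proof. by move=> tr1; rewrite ptrSB ptrS_tens mxtrace_ptrE tr1 scale1r subrr. Qed.

Lemma ptrE_evolve_eq_product (U rho : 'M[C]_(2 * 2)) (V : 'M[C]_2) :
  ptrE (evolve U (evolve (V *t 1%:M) (correlation_part rho))) = 0 ->
  ptrE (evolve U (evolve (V *t 1%:M) rho)) =
  ptrE (evolve U (evolve V (ptrE rho) *t ptrS rho)).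
Proof.
have -> : evolve (V *t 1%:M) (correlation_part rho) =
    evolve (V *t 1%:M) rho - evolve V (ptrE rho) *t ptrS rho.
  rewrite /correlation_part mulmxBr mulmxBl; congr (_ - _).
  by rewrite adjmx_tens adjmx1 !tensmx_mul mul1mx mulmx1.
by rewrite mulmxBr mulmxBl ptrEB => /eqP; rewrite subr_eq0 => /eqP.
Qed.

End Correlations.

Section CanonicalEvolution.
Variables (R : realType) (a : 'I_3 -> R).
Local Notation C := R[i].
Local Notation pauli := (@pauli R).
Local Notation to_complex := (map_mx (real_complex R)).
Local Notation pauli_pair := (@pauli_pair R).
Local Notation c j := (cos (a j *+ 2))%:C.
Local Notation s j := (sin (a j *+ 2))%:C.

Definition canonical_evolution k : 'M[C]_(2 * 2) :=
  involexp (pauli_pair k) (a k) *m (involexp (pauli_pair (k + 1)) (a (k + 1))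
    *m involexp (pauli_pair (k + 2)) (a (k + 2))).

Lemma unitary_canonical_evolution k : unitary (canonical_evolution k).
Proof.
have unitary_factor j : unitary (involexp (pauli_pair j) (a j)).
  by apply: unitary_involexp; [exact: pauli_pairK | exact: adj_pauli_pair].
by apply: unitaryM => //; exact: unitaryM.
Qed.

Lemma canonical_evolution_conj_pauli k :
  adjmx (canonical_evolution k) *m (pauli k *t 1%:M) *m canonical_evolution k =
  (pauli k *t 1%:M) *m involexp (pauli_pair (k + 2)) (a (k + 2) *+ 2)
                    *m involexp (pauli_pair (k + 1)) (a (k + 1) *+ 2).
Proof.
pose r j t := involexp (pauli_pair j) t; set S := pauli k *t 1%:M.
have adj_r j t : adjmx (r j t) = r j (- t) by exact/adj_involexp/adj_pauli_pair.
have r_comm i j s t : comm_mx (r i s) (r j t).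
  by apply/comm_involexp/comm_mx_sym/comm_involexp; exact: pauli_pair_comm.
have conj_r_comm t : r k (- t) *m S *m r k t = S.
  by apply: involexp_conj_comm; [exact: pauli_pairK | exact: pauli_system_comm].
have conj_r_anticomm j t : k != j -> r j (- t) *m S *m r j t = S *m r j (t *+ 2).
  move=> kj; apply: involexp_conj_anticomm; first exact: pauli_pairK.
  exact: pauli_system_anticomm.
rewrite -[canonical_evolution k]/(r k _ *m (r (k + 1) _ *m r (k + 2) _)).
rewrite -!/(r _ _); clearbody r S.
transitivity (r (k + 2) (- a (k + 2)) *m (r (k + 1) (- a (k + 1)) *m
    (r k (- a k) *m S *m r k (a k)) *m r (k + 1) (a (k + 1))) *m r (k + 2) (a (k + 2))).
  by rewrite !adjmxM !adj_r !mulmxA.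
rewrite conj_r_comm conj_r_anticomm ?ord3_cycle_neq //.
by rewrite mulmxA -mulmxA r_comm mulmxA conj_r_anticomm ?ord3_cycle_neq.
Qed.

Lemma heisenberg_pauli k :
  adjmx (canonical_evolution k) *m (pauli k *t 1%:M) *m canonical_evolution k =
    (c (k + 1) * c (k + 2)) *: (pauli k *t 1%:M)
  + (s (k + 1) * c (k + 2)) *: (pauli (k + 2) *t pauli (k + 1))
  - (c (k + 1) * s (k + 2)) *: (pauli (k + 1) *t pauli (k + 2))
  + (s (k + 1) * s (k + 2)) *: (1%:M *t pauli k).
Proof.
rewrite canonical_evolution_conj_pauli.
have S_X1 : (pauli k *t 1%:M) *m pauli_pair (k + 1) = 'i *: (pauli (k + 2) *t pauli (k + 1)).
  by rewrite tensmx_mul mul1mx pauliM tensmxZl.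
have S_X2 : (pauli k *t 1%:M) *m pauli_pair (k + 2) = 'i *: - (pauli (k + 1) *t pauli (k + 2)).
  by rewrite tensmx_mul mul1mx pauliM tensmxZl scaleNr scalerN.
have T_X1 : - (pauli (k + 1) *t pauli (k + 2)) *m pauli_pair (k + 1) = 'i *: (1%:M *t pauli k).
  by rewrite mulNmx tensmx_mul pauliK pauliM tensmxZr scaleNr opprK.
rewrite (mulmx_involexp _ S_X2) mulmxDl -!scalemxAl.
rewrite (mulmx_involexp _ S_X1) (mulmx_involexp _ T_X1) !scalerDr !scalerN !scalerA.
rewrite !(mulrC (c (k + 2))) !(mulrC (s (k + 2))).
exact: addrA.
Qed.

Lemma bloch_evolution k (M : 'M[C]_(2 * 2)) :
  \tr (pauli k *m ptrE (evolve (canonical_evolution k) M)) =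
    c (k + 1) * c (k + 2) * \tr (pauli k *m ptrE M)
  + s (k + 1) * c (k + 2) * correlation M (k + 2) (k + 1)
  - c (k + 1) * s (k + 2) * correlation M (k + 1) (k + 2)
  + s (k + 1) * s (k + 2) * \tr (pauli k *m ptrS M).
Proof.
have corrE i j : correlation M i j = \tr ((pauli i *t pauli j) *m M) by rewrite mxE.
rewrite !corrE !mxtrace_mul_ptrE mxtrace_mul_ptrS mxtrace_mul_evolve heisenberg_pauli.
move: (pauli k *t _) (pauli _ *t pauli _) (pauli _ *t pauli _) (_ *t pauli k) => A B D E.
rewrite !mulmxDl mulNmx -!scalemxAl !mxtraceD raddfN /=.
by rewrite !mxtraceZ.
Qed.

Lemma ptrE_evolve_eq0 k (U M : 'M[C]_(2 * 2)) :
  (forall j, U = canonical_evolution j) -> sin (a k *+ 2) = 0 ->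
  ptrE M = 0 -> ptrS M = 0 ->
  correlation M k (k + 1) = 0 -> correlation M k (k + 2) = 0 ->
  s (k + 1) * c (k + 2) * correlation M (k + 2) (k + 1) =
  c (k + 1) * s (k + 2) * correlation M (k + 1) (k + 2) ->
  ptrE (evolve U M) = 0.
Proof.
move=> UE sin_2ak ptrE0 ptrS0 corr1 corr2 corr_balance; apply: pauli_basis_ext.
  have uU : unitary U by rewrite (UE k); exact: unitary_canonical_evolution.
  rewrite mxtrace_ptrE mxtrace_evolve_unitary //.
  by rewrite -mxtrace_ptrE ptrE0 mxtrace0.
move=> j; rewrite (UE j) bloch_evolution ptrE0 ptrS0 !mulmx0 !mxtrace0 !mulr0 add0r addr0.
move: j; apply: (ord3_cycleP (k := k)).
- by rewrite corr_balance subrr.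
- by rewrite -!addrA !ord3_add !addr0 corr2 sin_2ak !mulr0 mul0r subrr.
- by rewrite -!addrA !ord3_add !addr0 corr1 sin_2ak !(mulr0, mul0r) subrr.
Qed.

Lemma exists_unitary_ptrE_evolve_eq0 k (U M : 'M[C]_(2 * 2)) :
  (forall j, U = canonical_evolution j) -> sin (a k *+ 2) = 0 ->
  adjmx M = M -> ptrE M = 0 -> ptrS M = 0 ->
  exists2 V : 'M[C]_2, unitary V & ptrE (evolve U (evolve (V *t 1%:M) M)) = 0.
Proof.
move=> UE sin_2ak M_herm ptrE0 ptrS0; have [T corrM] := correlation_real M_herm.
pose p := - (cos (a (k + 1) *+ 2) * sin (a (k + 2) *+ 2)).
pose q := sin (a (k + 1) *+ 2) * cos (a (k + 2) *+ 2).
have [gs gsP [Nk1 Nk2 N_balance]] : exists2 gs, all (@is_givens R) gs &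
    let N := givens_word gs *m T in
    [/\ N k (k + 1) = 0, N k (k + 2) = 0 & p * N (k + 1) (k + 2) + q * N (k + 2) (k + 1) = 0].
  by apply: exists_givens_word_clear_row; rewrite ?ord3_cycle_neq.
have [V uV OV] := givens_word_unitary_lift gsP; exists V => //.
set MV := evolve (V *t 1%:M) M.
have corrMV : correlation MV = to_complex (givens_word gs *m T).
  by rewrite correlation_evolve_system // OV corrM map_mxM.
apply: (ptrE_evolve_eq0 UE sin_2ak); rewrite ?corrMV ?[to_complex _ _ _]mxE.
- by rewrite ptrE_evolve_tens ?ptrE0 ?mulmx0 ?mul0mx //; exact: unitary1.
- by rewrite ptrS_evolve_tens // ptrS0 mulmx0 mul0mx.
- by rewrite Nk1 rmorph0.
- by rewrite Nk2 rmorph0.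
- move: N_balance; rewrite /p /q mulNr addrC => /eqP; rewrite subr_eq0 => /eqP balance.
  by rewrite -!rmorphM balance.
Qed.

(* The local factors are absorbed into the state: [L1], [L2] and [R2] act on the
   reduced states only, and [R1] is undone by [V]. *)
Lemma exists_unitary_ptrE_evolve_local_eq0 k (Omega M : 'M[C]_(2 * 2))
    (L1 L2 R1 R2 : 'M[C]_2) :
  (forall j, Omega = canonical_evolution j) -> sin (a k *+ 2) = 0 ->
  unitary L2 -> unitary R1 -> unitary R2 ->
  adjmx M = M -> ptrE M = 0 -> ptrS M = 0 ->
  let U := (L1 *t L2) *m Omega *m (R1 *t R2) in
  exists2 V : 'M[C]_2, unitary V & ptrE (evolve U (evolve (V *t 1%:M) M)) = 0.
Proof.
move=> OmegaE sin_2ak uL2 uR1 uR2 M_herm ptrE0 ptrS0 U.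
pose M2 := evolve (1%:M *t R2) M.
have [W uW ptrE_W] : exists2 W : 'M[C]_2, unitary W &
    ptrE (evolve Omega (evolve (W *t 1%:M) M2)) = 0.
  apply: (exists_unitary_ptrE_evolve_eq0 OmegaE sin_2ak).
  - by rewrite adjmx_evolve M_herm.
  - by rewrite ptrE_evolve_tens // ptrE0 mulmx0 mul0mx.
  - by rewrite ptrS_evolve_tens ?ptrS0 ?mulmx0 ?mul0mx //; exact: unitary1.
exists (adjmx R1 *m W); first by apply: unitaryM => //; exact: unitary_adj.
have R1V : R1 *m (adjmx R1 *m W) = W by rewrite mulmxA; case: uR1 => -> _; rewrite mul1mx.
have R_V : (R1 *t R2) *m ((adjmx R1 *m W) *t 1%:M) = (W *t 1%:M) *m (1%:M *t R2).
  by rewrite !tensmx_mul R1V mulmx1 mul1mx mulmx1.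
rewrite 2!evolve_mulmx ptrE_evolve_tens // -[evolve _ (evolve _ M)]evolve_mulmx R_V.
by rewrite evolve_mulmx ptrE_W mulmx0 mul0mx.
Qed.

End CanonicalEvolution.

Section InteractionHamiltonian.
Variables (R : realType) (a1 a2 a3 : R).
Local Notation C := R[i].
Local Notation pauli_pair := (@pauli_pair R).

Definition coupling (k : 'I_3) : R := [:: a1; a2; a3]`_k.

Lemma HgenE : Hgen a1 a2 a3 = \sum_j (coupling j)%:C *: pauli_pair j.
Proof. by rewrite (sum_ord3_cycle 0) !add0r. Qed.

(* The three factors commute, so any axis can be put first. *)
Lemma expmx_Hgen (Omega : 'M[C]_(2 * 2)) k : is_expmx (- 'i *: Hgen a1 a2 a3) Omega ->
  Omega = canonical_evolution coupling k.
Proof.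
move=> expOmega; apply: is_expmx_unique expOmega _.
pose s := [:: k; k + 1; k + 2].
have -> : Hgen a1 a2 a3 = \sum_(j <- s) (coupling j)%:C *: pauli_pair j.
  by rewrite HgenE (sum_ord3_cycle k) !big_cons big_nil addr0 [RHS]addrA.
have -> : canonical_evolution coupling k =
    \big[mulmx/1%:M]_(j <- s) involexp (pauli_pair j) (coupling j).
  by rewrite !big_cons big_nil [X in _ = _ *m (_ *m X)]mulmx1.
by apply: is_expmx_involutions; [exact: pauli_pairK | exact: pauli_pair_comm].
Qed.

Lemma sin_double_inS (a : R) : inS a -> sin (a *+ 2) = 0.
Proof.
case=> n ->; have -> : (n%:R * pi / 2) *+ 2 = 0 + pi *+ n :> R.
  by rewrite add0r -mulr_natl -[pi *+ n]mulr_natl; field.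
by rewrite (alternatingn (@sinDpi R)) sin0 mulr0.
Qed.

Lemma exactly_one_inS_coupling : exactly_one_inS a1 a2 a3 -> exists k, inS (coupling k).
Proof. by case=> [[]|[_ []]|[_ []]]; [exists 0 | exists 1 | exists 2]. Qed.

End InteractionHamiltonian.

Theorem theorem1 (R : realType) (a1 a2 a3 : R) (Omega : 'M[R[i]]_(2 * 2))
  (L1 L2 R1 R2 : 'M[R[i]]_2) :
  is_expmx (- 'i *: Hgen a1 a2 a3) Omega ->
  exactly_one_inS a1 a2 a3 ->
  unitary L1 -> unitary L2 -> unitary R1 -> unitary R2 ->
  forall rhoSE : 'M[R[i]]_(2 * 2), density rhoSE ->
  let U := (L1 *t L2) *m Omega *m (R1 *t R2) in
  let rhoS := ptrE rhoSE in
  exists (V : 'M[R[i]]_2) (zeta : 'M[R[i]]_2),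
    [/\ unitary V, givens_product (rotO V), density zeta &
      ptrE (U *m ((V *t 1%:M) *m rhoSE *m adjmx (V *t 1%:M)) *m adjmx U)
      = ptrE (U *m ((V *m rhoS *m adjmx V) *t zeta) *m adjmx U)].
Proof.
move=> expOmega one_inS _ uL2 uR1 uR2 rho rho_density U rhoS.
have [k /sin_double_inS sin_2ak] := exactly_one_inS_coupling one_inS.
have [rho_herm _ rho_tr1] := rho_density.
have [V uV ptrE0] := exists_unitary_ptrE_evolve_local_eq0 L1
  (fun j => expmx_Hgen j expOmega) sin_2ak uL2 uR1 uR2 (adj_correlation_part rho_herm)
  (ptrE_correlation_part rho_tr1) (ptrS_correlation_part rho_tr1).
exists V, (ptrS rho); split; first exact: uV.
- exact: givens_product_rotO.
- exact: density_ptrS.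
- exact: ptrE_evolve_eq_product.
Qed.
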